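(* Let $0\le \alpha<1$ and let $n,g$ be integers with $2\le g\le n-1$. Let $G$ be a strongly connected simple digraph on $n$ vertices with girth $g$. Then $$\lambda_\alpha(G)\ge \lambda_\alpha(C_{n,g})>1,$$ with equality $\lambda_\alpha(G)=\lambda_\alpha(C_{n,g})$ if and only if $G\cong C_{n,g}$.
   Context: All digraphs are simple (no loops, no multiple arcs). For a digraph $G$ on vertex set $\{v_1,\dots,v_n\}$, $A(G)=(a_{ij})$ is the adjacency matrix ($a_{ij}=1$ if $(v_i,v_j)$ is an arc, $0$ otherwise), $D(G)$ is the diagonal matrix of outdegrees, and for $\alpha\in[0,1)$, $A_\alpha(G)=\alpha D(G)+(1-\alpha)A(G)$. The $A_\alpha$ spectral radius $\lambda_\alpha(G)$ is the largest modulus of the eigenvalues of $A_\alpha(G)$. A digraph is strongly connected if for every ordered pair of vertices there is a directed path from the first to the second. The girth is the length of a shortest directed cycle. $C_{n,g}$ is the digraph on vertices $v_1,\dots,v_n$ whose arcs are those of the directed cycle $v_1\to v_2\to\cdots\to v_g\to v_1$ together with those of the directed path $v_g\to v_{g+1}\to\cdots\to v_n\to v_1$. *)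

(* Defs.v *)
From mathcomp Require Import all_boot all_order all_algebra.
From mathcomp Require Import complex.
From mathcomp Require Import boolp classical_sets reals.

Set Implicit Arguments.
Unset Strict Implicit.
Unset Printing Implicit Defensive.

Import Order.TTheory GRing.Theory Num.Theory.
Local Open Scope ring_scope.

(* A simple digraph on v_1, ..., v_n is an irreflexive e : rel 'I_n, where
   e i j means that (v_(i+1), v_(j+1)) is an arc.  Opposite arcs e i j and
   e j i may coexist; they form a directed cycle of length 2. *)

Definition strongly_connected n (e : rel 'I_n) : Prop :=
  forall x y, connect e x y.

Definition dicycle n (e : rel 'I_n) (c : seq 'I_n) : bool :=
  [&& c != [::], cycle e c & uniq c].

Definition has_girth n (e : rel 'I_n) (g : nat) : Prop :=
  (exists2 c, dicycle e c & size c = g) /\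
  (forall c, dicycle e c -> (g <= size c)%N).

Definition digraph_iso n (e e' : rel 'I_n) : Prop :=
  exists2 f : 'I_n -> 'I_n, bijective f & forall x y, e' (f x) (f y) = e x y.

(* First line: v_1 -> ... -> v_g -> v_1;
   second line: v_g -> v_(g+1) -> ... -> v_n -> v_1. *)
Definition Cng (n g : nat) : rel 'I_n := fun i j =>
  [|| (i.+1 < g)%N && (j == i.+1 :> nat), (i.+1 == g) && (j == 0 :> nat),
      (g <= i.+1)%N && (j == i.+1 :> nat) | (i.+1 == n) && (j == 0 :> nat)].
Arguments Cng : clear implicits.

Definition adjacency_mx (R : realType) n (e : rel 'I_n) : 'M[R]_n :=
  \matrix_(i, j) (e i j)%:R.

Definition outdeg n (e : rel 'I_n) (i : 'I_n) : nat := #|[set j | e i j]%SET|.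

Definition outdeg_mx (R : realType) n (e : rel 'I_n) : 'M[R]_n :=
  diag_mx (\row_i (outdeg e i)%:R).

Definition Aalpha (R : realType) (alpha : R) n (e : rel 'I_n) : 'M[R]_n :=
  alpha *: outdeg_mx R e + (1 - alpha) *: adjacency_mx R e.

Definition eigenvalue_moduli (R : realType) n (M : 'M[R]_n) : set R :=
  [set r | exists2 z : R[i],
     eigenvalue (map_mx (real_complex R) M) z & Normc.normc z = r]%classic.

(* For n > 0 the supremum is a maximum, see spectral_radius_max. *)
Definition spectral_radius (R : realType) n (M : 'M[R]_n) : R :=
  sup (eigenvalue_moduli M).

Definition lambda_alpha (R : realType) (alpha : R) n (e : rel 'I_n) : R :=
  spectral_radius (Aalpha alpha e).

Lemma spectral_radius_max (R : realType) n (M : 'M[R]_n) : (0 < n)%N ->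
  eigenvalue_moduli M (spectral_radius M) /\
  (forall r, eigenvalue_moduli M r -> r <= spectral_radius M).
Proof.
move=> n0; set p := char_poly (map_mx (real_complex R) M).
have [s ps] := closed_field_poly_normal p.
have p1 : lead_coef p = 1 by exact: (monicP (char_poly_monic _)).
have evE z : eigenvalue (map_mx (real_complex R) M) z = (z \in s).
  by rewrite eigenvalue_root_char -/p ps p1 scale1r root_prod_XsubC.
have sn : s != [::].
  apply/eqP => s0; move: ps; rewrite s0 big_nil p1 scale1r => ps.
  have := size_char_poly (map_mx (real_complex R) M).
  by rewrite -/p ps size_poly1 => -[n0']; rewrite -n0' in n0.
have [z zs zmax] : exists2 z, z \in s &
    forall y, y \in s -> Normc.normc y <= Normc.normc z.
  elim: s sn {ps evE} => // a s IH _; have [->|/IH[z zs zm]] := eqVneq s [::].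
    by exists a; rewrite ?mem_head// => y; rewrite inE => /eqP ->.
  have [az|za] := leP (Normc.normc a) (Normc.normc z).
    exists z; first by rewrite inE zs orbT.
    by move=> y; rewrite inE => /orP[/eqP ->//|/zm].
  exists a; first exact: mem_head.
  move=> y; rewrite inE => /orP[/eqP ->//|/zm yz].
  exact: le_trans yz (ltW za).
have ubz : ubound (eigenvalue_moduli M) (Normc.normc z).
  by move=> r [y]; rewrite evE => /zmax ? <-.
have mz : eigenvalue_moduli M (Normc.normc z) by exists z; rewrite ?evE.
have supE : spectral_radius M = Normc.normc z.
  apply/eqP; rewrite eq_le; apply/andP; split.
    by apply: ge_sup => //; exists (Normc.normc z).
  by apply: ub_le_sup => //; exists (Normc.normc z).
by rewrite supE; split=> // r /ubz.
Qed.

(* Main.v *)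
Require Import Defs.
From mathcomp Require Import all_boot all_order all_algebra.
From mathcomp Require Import complex.
From mathcomp Require Import boolp classical_sets reals.
From mathcomp Require Import topology normedtype derive.
From mathcomp Require Import zify ring lra.
Import Order.TTheory GRing.Theory Num.Theory numFieldNormedType.Exports.
Local Open Scope ring_scope.

Set Implicit Arguments.
Unset Strict Implicit.
Unset Printing Implicit Defensive.

(* Let mu be the A_alpha spectral radius of C_{n,g}; its Perron vector is
   t^dist(-, v_g), where 0 < t < 1 and mu = alpha + (1 - alpha) / t.  As g < n
   and G is strongly connected, some vertex u on a shortest cycle of G has two
   out-neighbours x1 and x2, with x1 its successor on the cycle.  The vector
   y i = t^dist(i, u) then satisfies A_alpha(G) y >= mu y: a vertex i <> u has
   an out-neighbour one step closer to u, which is enough, while at u one uses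
   dist(x1, u) <= g - 1 and dist(x2, u) <= n - 1.  Pairing with a positive left
   eigenvector of A_alpha(G) gives lambda_alpha(G) >= mu.  Equality forces
   A_alpha(G) y = mu y, so that u has out-neighbours x1 and x2 only, any other
   vertex has a single one, and dist(x2, u) = n - 1; hence dist(-, u) is a
   bijection onto 0, ..., n - 1 which determines G up to isomorphism. *)

Lemma connect_path_ltn {n} {e : rel 'I_n} {x y} : connect e x y ->
  exists p, [/\ path e x p, last x p = y & (size p < n)%N].
Proof.
case/connectP => p ep ->; case/shortenP: ep => q eq uq _.
exists q; split=> //.
have := max_card (mem (x :: q)).
by rewrite (card_uniqP uq) card_ord.
Qed.

(** * Perron vectors of nonnegative irreducible matrices *)

Section Perron.
Variables (R : realType) (n : nat) (M : 'M[R]_n) (e : rel 'I_n).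
Hypothesis M_ge0 : forall i j, 0 <= M i j.

(** The added identity makes positive entries persist under iteration, so that periodicity of [M]
    does no harm. *)
Let T (v : 'rV[R]_n) : 'rV[R]_n := v + v *m M.

Lemma mulmx_row_ge0 {v : 'rV[R]_n} j :
  (forall i, 0 <= v 0 i) -> 0 <= (v *m M) 0 j.
Proof. by move=> v0; rewrite mxE sumr_ge0// => i _; rewrite mulr_ge0. Qed.

Lemma iter_addmul_ge0 (v : 'rV[R]_n) k j :
  (forall i, 0 <= v 0 i) -> 0 <= (iter k T v) 0 j.
Proof.
move=> v0; elim: k j => //= k IH j.
by rewrite mxE addr_ge0// mulmx_row_ge0.
Qed.

Lemma iter_addmul_gt0W {v : 'rV[R]_n} {k m j} : (forall i, 0 <= v 0 i) ->
  (k <= m)%N -> 0 < (iter k T v) 0 j -> 0 < (iter m T v) 0 j.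
Proof.
move=> v0 /subnK <- kp; elim: (m - k)%N => //= d IH.
rewrite mxE ltr_wpDr// mulmx_row_ge0// => i; exact: iter_addmul_ge0.
Qed.

Hypothesis M_gt0 : forall i j, e i j -> 0 < M i j.
Hypothesis e_conn : forall i j, connect e i j.

Lemma iter_addmul_gt0_path (v : 'rV[R]_n) i p : (forall i, 0 <= v 0 i) ->
  0 < v 0 i -> path e i p -> 0 < (iter (size p) T v) 0 (last i p).
Proof.
move=> v0 vi; elim/last_ind: p => [|p x IH]//=.
rewrite rcons_path last_rcons size_rcons /= => /andP[/IH px elx].
rewrite mxE ltr_wpDl ?iter_addmul_ge0// mxE (bigD1 (last i p))//=.
rewrite ltr_wpDr ?mulr_gt0 ?M_gt0// sumr_ge0// => j _.
by rewrite mulr_ge0// iter_addmul_ge0.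
Qed.

(** Positivity spreads along one arc per step and persists, and every vertex is reached in fewer
    than [n] steps. *)
Lemma iter_addmul_gt0 (v : 'rV[R]_n) j : (forall i, 0 <= v 0 i) ->
  v != 0 -> 0 < (iter n T v) 0 j.
Proof.
move=> v0 vn0; have [i vi] : exists i, v 0 i != 0.
  apply/existsP; apply: contraNT vn0; rewrite negb_exists => /forallP v00.
  by apply/eqP/rowP => i; rewrite mxE; apply/eqP/negPn.
have [p [ep <- /ltnW pn]] := connect_path_ltn (e_conn i j).
apply: iter_addmul_gt0W pn _ => //; apply: iter_addmul_gt0_path => //.
by rewrite lt0r vi v0.
Qed.

(** Collatz-Wielandt pairs: the largest feasible [s] is the Perron root. Normalising [w] keeps the
    set of pairs compact. *)
Let feasible (w : 'rV[R]_n) (s : R) := [/\ forall i, 0 <= w 0 i,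
  \sum_i w 0 i = 1, 0 <= s & forall j, s * w 0 j <= (w *m M) 0 j].

(** Sum the inequalities over [j] and use that the entries of [w] are at most 1. *)
Lemma feasible_le w s : feasible w s -> s <= \sum_i \sum_j M i j.
Proof.
case=> w0 w1 _ sw.
have -> : s = \sum_j s * w 0 j by rewrite -mulr_sumr w1 mulr1.
apply: (@le_trans _ _ (\sum_j (w *m M) 0 j)); first exact: ler_sum.
rewrite exchange_big/=; apply: ler_sum => j _.
rewrite mxE; apply: ler_sum => i _.
rewrite ler_piMl// -w1 (bigD1 i)//= lerDl sumr_ge0//.
Qed.

(** The feasible pairs are the points of the compact box [K] that lie in the closed set [C], so the
    second coordinate attains its maximum on them. *)
Lemma feasible_max : (0 < n)%N ->
  exists w r, feasible w r /\ forall w' s, feasible w' s -> s <= r.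
Proof.
move=> n0; pose b := \sum_i \sum_j M i j.
pose K : set ('rV[R]_n * R) :=
  ([set w : 'rV[R]_n | forall i, `[0, 1] (w ord0 i)] `*` `[0, b])%classic.
pose A := [set p : 'rV[R]_n * R | feasible p.1 p.2]%classic.
have Kc : compact K.
  apply: compact_setX; last exact: segment_compact.
  apply: (rV_compact (T := R) (A := fun=> `[0, 1]%classic)) => i.
  exact: segment_compact.
have coordC i : continuous (fun p : 'rV[R]_n * R => p.1 0 i).
  move=> p; apply: (@continuous_comp _ _ _ fst (fun w : 'rV[R]_n => w 0 i)).
    exact: cvg_fst.
  exact: coord_continuous.
pose mass (p : 'rV[R]_n * R) := \sum_i p.1 0 i.
pose excess j (p : 'rV[R]_n * R) := (p.1 *m M) 0 j - p.2 * p.1 0 j.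
pose C := ([set p | mass p = 1%R] `&`
  \bigcap_(j in [set: 'I_n]) [set p | (0 <= excess j p)%R])%classic.
have Cc : closed C.
  apply: closedI.
    apply: (@closed_comp _ _ mass [set 1%R]%classic).
      move=> p _; apply: cvg_big => [|i _]; first exact: add_continuous.
      exact: coordC.
    exact: closed_eq.
  apply: closed_bigI => j _.
  apply: (@closed_comp _ _ (excess j) [set x | 0 <= x]%classic).
    move=> p _; apply: cvgB.
      rewrite /=; under eq_fun do rewrite mxE.
      rewrite mxE.
      apply: cvg_big => [|i _]; first exact: add_continuous.
      apply: cvgM; [exact: coordC|exact: cvg_cst].
    apply: cvgM; [exact: cvg_snd|exact: coordC].
  exact: closed_ge.
have AE : A = (K `&` C)%classic.
  apply/seteqP; split => -[w s].
    move=> fws; have := feasible_le fws; case: fws => /= w0 w1 s0 sw sb.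
    split; split => //=; last by move=> j _ /=; rewrite subr_ge0.
      move=> i; rewrite /= in_itv/= w0/= -w1 (bigD1 i)//= lerDl sumr_ge0//.
    by rewrite in_itv/= s0.
  case=> -[/= w0]; rewrite in_itv/= => /andP[s0 _] [/= w1 sw].
  split => // [i|j]; first by have := w0 i; rewrite in_itv/= => /andP[].
  by have := sw j I; rewrite /= subr_ge0.
have Ac : compact A by rewrite AE; apply: compact_closedI.
have A0 : (A !=set0)%classic.
  exists (delta_mx 0 (Ordinal n0), 0); split=> [i|||j] /=.
  - by rewrite mxE ler0n.
  - rewrite (bigD1 (Ordinal n0))//= mxE !eqxx big1 ?addr0// => i /negbTE ni.
    by rewrite mxE ni andbF.
  - by [].
  - rewrite mul0r mulmx_row_ge0// => i; by rewrite mxE ler0n.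
have [|[w r]] := compact_EVT_max (f := snd) A0 Ac.
  by apply: continuous_subspaceT => p; exact: cvg_snd.
rewrite inE => fwr rmax; exists w, r; split=> // w' s fs.
by apply: (rmax (w', s)); rewrite inE.
Qed.

(* A feasible pair (w, r) with r maximal has w M = r w: otherwise (1 + M)^n
   turns the nonzero nonnegative row w M - r w into a positive one, and r could
   be increased. *)
Lemma perron_vector : (0 < n)%N ->
  exists r (w : 'rV[R]_n), [/\ 0 <= r, forall i, 0 < w 0 i & w *m M = r *: w].
Proof.
move=> n0; have [w [r [[w0 w1 r0 rw] rmax]]] := feasible_max n0.
have wn0 : w != 0.
  apply: contra_eq_neq w1 => ->; rewrite big1 ?(eq_sym 0) ?oner_neq0// => i _.
  by rewrite mxE.
exists r; pose v k := iter k T w.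
have v_ge0 k j : 0 <= v k 0 j by exact: iter_addmul_ge0.
have v_gt0 j : 0 < v n 0 j by exact: iter_addmul_gt0.
(* By [uE], this is also the defect of [v k], because [T] commutes with multiplication by [M]. *)
pose u k := iter k T (w *m M - r *: w).
have uE k : u k = v k *m M - r *: v k.
  elim: k => [//|k IH]; rewrite -[u k.+1]/(T (u k)) -[v k.+1]/(T (v k)) IH.
  rewrite /T mulmxBl [(v k + _) *m M]mulmxDl scalerDr -scalemxAl.
  by rewrite addrACA opprD.
have u0 i : 0 <= (w *m M - r *: w) 0 i by have := rw i; rewrite !mxE subr_ge0.
(* If [w] is an eigenvector, so is [v n], whose entries are known to be positive. *)
have [/eqP|un0] := eqVneq (w *m M - r *: w) 0.
  rewrite subr_eq0 => /eqP wM; exists (v n); split=> //.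
  suff u00 k : u k = 0 by apply/eqP; rewrite -subr_eq0 -uE u00.
  rewrite /u wM subrr; elim: k => //= k ->.
  by rewrite /T mul0mx addr0.
have u_gt0 j : 0 < u n 0 j by exact: iter_addmul_gt0.
pose s := \sum_j v n 0 j.
have s_gt0 : 0 < s.
  rewrite /s (bigD1 (Ordinal n0))//= ltr_pwDl// sumr_ge0// => i _; exact: ltW.
(* [d] is the least ratio of entries of [u n] and [v n]; the normalised [v n] is then feasible for
   [r + d], against the maximality of [r]. *)
have [d d0 dP] : exists2 d, 0 < d & forall j, d * v n 0 j <= u n 0 j.
  pose q j := u n 0 j / v n 0 j.
  have [j _ jmin] := Order.TotalTheory.arg_minP q (isT : xpredT (Ordinal n0)).
  exists (q j); first by rewrite divr_gt0.
  by move=> i; rewrite -ler_pdivlMr// jmin.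
have := rmax (s^-1 *: v n) (r + d); rewrite gerDl leNgt d0.
move=> /(_ _)/negP; case=> //.
split=> [i|||j].
- by rewrite mxE mulr_ge0 ?invr_ge0 ?ltW.
- by under eq_bigr do rewrite mxE; rewrite -mulr_sumr mulVf ?gt_eqF.
- by rewrite addr_ge0// ltW.
- rewrite -scalemxAl !mxE mulrCA ler_pM2l ?invr_gt0// mulrDl -lerBrDl.
  by have := dP j; rewrite uE !mxE.
Qed.

End Perron.

(** * Bounding the spectral radius by positive vectors *)

Lemma eigenvalue_trmx (F : fieldType) n (A : 'M[F]_n) a :
  eigenvalue A^T a = eigenvalue A a.
Proof.
(* [eigenvalue] refers to row vectors, so right eigenvectors go through the transpose; the rank of
   [A - a] is the same. *)
rewrite /eigenvalue /eigenspace !kermx_eq0 /row_free.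
by rewrite -[in RHS]mxrank_tr linearB/= tr_scalar_mx.
Qed.

Section SpectralRadius.
Variables (R : realType) (n : nat) (M : 'M[R]_n).
Hypothesis n_gt0 : (0 < n)%N.

Lemma normc_real (x : R) : 0 <= x -> Normc.normc (real_complex R x) = x.
Proof. by move=> x0; rewrite /= expr0n addr0 sqrtr_sqr ger0_norm. Qed.

Lemma normc_sum (I : finType) (F : I -> R[i]) :
  Normc.normc (\sum_i F i) <= \sum_i Normc.normc (F i).
Proof.
elim/big_ind2: _ => [|x a y b xa yb|//]; first by rewrite Normc.normc0.
exact: le_trans (le_normcD _ _) (lerD xa yb).
Qed.

Lemma normc_ge0 (z : R[i]) : 0 <= Normc.normc z.
Proof. by case: z => a b; exact: sqrtr_ge0. Qed.

Lemma eigenvalue_le_spectral_radius r :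
  0 <= r -> eigenvalue M r -> r <= spectral_radius M.
Proof.
move=> r0 Mr; apply: (spectral_radius_max M n_gt0).2.
exists (real_complex R r); last exact: normc_real.
by rewrite eigenvalue_map.
Qed.

(** The moduli [a] of a left eigenvector for [z] satisfy |z| a <= a M entrywise; pairing with the
    positive [y] gives |z| <= mu. *)
Lemma spectral_radius_pos_eigenvector (y : 'cV[R]_n) mu :
  (forall i j, 0 <= M i j) -> (forall i, 0 < y i 0) -> 0 <= mu ->
  M *m y = mu *: y -> spectral_radius M = mu.
Proof.
move=> M0 y0 mu0 My; apply/le_anti/andP; split; last first.
  apply: eigenvalue_le_spectral_radius => //.
  rewrite -eigenvalue_trmx; apply/eigenvalueP; exists y^T.
    by rewrite -trmx_mul My linearZ.
  apply/eqP => /rowP/(_ (Ordinal n_gt0)); rewrite !mxE => yi.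
  by have := y0 (Ordinal n_gt0); rewrite yi ltxx.
have [[z /eigenvalueP[v vz vn0] <-] _] := spectral_radius_max M n_gt0.
pose a i := Normc.normc (v 0 i).
have a0 i : 0 <= a i by exact: normc_ge0.
have aM j : Normc.normc z * a j <= \sum_i a i * M i j.
  rewrite -Normc.normcM; have /rowP/(_ j) := vz; rewrite !mxE => <-.
  apply: le_trans (normc_sum _) _; apply: ler_sum => i _.
  by rewrite Normc.normcM mxE normc_real.
have ay_gt0 : 0 < \sum_i a i * y i 0.
  have [i vi] : exists i, v 0 i != 0.
    apply/existsP; apply: contraNT vn0; rewrite negb_exists => /forallP v00.
    by apply/eqP/rowP => i; rewrite mxE; apply/eqP/negPn.
  have ai : 0 < a i.
    rewrite lt0r a0 andbT; apply: contra vi => /eqP/Normc.eq0_normc ->.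
    exact: eqxx.
  rewrite (bigD1 i)//= ltr_wpDr ?mulr_gt0// sumr_ge0// => j _.
  by rewrite mulr_ge0// ltW.
rewrite -(ler_pM2r ay_gt0) !mulr_sumr.
apply: (@le_trans _ _ (\sum_j (\sum_i a i * M i j) * y j 0)).
  by apply: ler_sum => j _; rewrite mulrA ler_pM2r.
under eq_bigr do rewrite mulr_suml.
rewrite exchange_big/=; apply: ler_sum => i _.
have /colP/(_ i) := My; rewrite !mxE => yi.
rewrite mulrCA -yi mulr_sumr; apply: ler_sum => j _.
by rewrite mulrA.
Qed.

(** For a positive left eigenvector [w] with eigenvalue [r], the nonnegative terms w_i (M y - mu
    y)_i add up to (r - mu) (w y). Hence mu <= r, and r = mu makes every term vanish. *)
Lemma spectral_radius_ge (e : rel 'I_n) (y : 'cV[R]_n) mu :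
  (forall i j, 0 <= M i j) -> (forall i j, e i j -> 0 < M i j) ->
  (forall i j, connect e i j) -> (forall i, 0 < y i 0) ->
  (forall i, mu * y i 0 <= (M *m y) i 0) ->
  mu <= spectral_radius M /\ (spectral_radius M = mu -> M *m y = mu *: y).
Proof.
move=> M0 Me ec y0 muy.
have [r [w [r0 w0 wM]]] := perron_vector M0 Me ec n_gt0.
have wy_gt0 : 0 < (w *m y) 0 0.
  rewrite mxE (bigD1 (Ordinal n_gt0))//= ltr_wpDr ?mulr_gt0//.
  by rewrite sumr_ge0// => j _; rewrite mulr_ge0 ?ltW.
have wE : \sum_i w 0 i * ((M *m y) i 0 - mu * y i 0) = (r - mu) * (w *m y) 0 0.
  transitivity ((w *m (M *m y - mu *: y)) 0 0).
    by rewrite mxE; apply: eq_bigr => i _; rewrite !mxE.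
  rewrite mulmxBr mulmxA wM -scalemxAl -scalemxAr -scalerBl mxE//.
have w_ge0 i : true -> 0 <= w 0 i * ((M *m y) i 0 - mu * y i 0).
  by move=> _; rewrite mulr_ge0 ?subr_ge0 ?muy ?ltW.
have mur : mu <= r.
  by rewrite -subr_ge0 -(pmulr_lge0 _ wy_gt0) -wE sumr_ge0.
have rM : r <= spectral_radius M.
  apply: eigenvalue_le_spectral_radius => //; apply/eigenvalueP; exists w => //.
  apply/eqP => /rowP/(_ (Ordinal n_gt0)); rewrite mxE => wi.
  by have := w0 (Ordinal n_gt0); rewrite wi ltxx.
split; first exact: le_trans mur rM.
move=> Mmu; have rmu : r = mu by apply/le_anti; rewrite mur -Mmu rM.
have := psumr_eq0P w_ge0; rewrite wE rmu subrr mul0r => /(_ erefl) z.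
apply/colP => i; have /eqP := z i isT; rewrite mulf_eq0 gt_eqF//= subr_eq0.
by move=> /eqP ->; rewrite mxE.
Qed.

End SpectralRadius.

(** * The matrix A_alpha and the rate [t] *)

Section AalphaTheory.
Variables (R : realType) (alpha : R) (n : nat) (e : rel 'I_n).

(** The diagonal entry is shared equally among the out-arcs, so that each arc contributes one
    term. *)
Lemma Aalpha_mul_col (y : 'cV[R]_n) i : (Aalpha alpha e *m y) i 0 =
  \sum_(j | e i j) (alpha * y i 0 + (1 - alpha) * y j 0).
Proof.
rewrite /Aalpha mulmxDl -!scalemxAl mul_diag_mx !mxE big_split/=; congr +%R.
  by rewrite /outdeg cardsE sumr_const mulrCA mulr_natl.
rewrite mulr_sumr [RHS]big_mkcond; apply: eq_bigr => j _.
by rewrite mxE; case: (e i j); rewrite ?mul1r// mul0r mulr0.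
Qed.

Hypothesis alpha01 : 0 <= alpha < 1.

Lemma Aalpha_ge0 i j : 0 <= Aalpha alpha e i j.
Proof.
case/andP: alpha01 => a0 a1; rewrite !mxE.
by rewrite addr_ge0 ?mulr_ge0 ?mulrn_wge0 ?ler0n ?subr_ge0 ?(ltW a1).
Qed.

Lemma Aalpha_gt0 i j : e i j -> 0 < Aalpha alpha e i j.
Proof.
case/andP: alpha01 => a0 a1 eij; rewrite !mxE eij.
by rewrite ltr_wpDl ?mulr_ge0 ?mulrn_wge0 ?ler0n// mulr1 subr_gt0.
Qed.

End AalphaTheory.

(* Eliminating mu leaves (1 - alpha) (t^g + t^n) + alpha t = 1 - alpha, which
   has a root t in ]0, 1[ by the intermediate value theorem. *)
Lemma exists_rate (R : realType) (alpha : R) (g n : nat) :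
  0 <= alpha < 1 -> (0 < g)%N -> (0 < n)%N ->
  exists t mu : R, [/\ 0 < t < 1, 1 < mu, mu * t = alpha * t + (1 - alpha)
    & mu = alpha + alpha + (1 - alpha) * (t ^+ g.-1 + t ^+ n.-1)].
Proof.
move=> /andP[a0 a1] g0 n0.
pose q : {poly R} :=
  (1 - alpha) *: ('X^g + 'X^n) + alpha *: 'X - (1 - alpha)%:P.
have qE x : q.[x] = (1 - alpha) * (x ^+ g + x ^+ n) + alpha * x - (1 - alpha).
  by rewrite !hornerE.
have q0 : q.[0] < 0 by rewrite qE !expr0n !gtn_eqF//= addr0 !mulr0; lra.
have q1 : 0 < q.[1] by rewrite qE !expr1n; lra.
have q01 : q.[0] <= 0 <= q.[1] by rewrite !ltW.
have [t /andP[t0 t1] /rootP qt] := poly_ivt ler01 q01.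
have tn0 : 0 < t.
  rewrite lt0r t0 andbT; apply: contraTneq q0 => t00.
  by rewrite -t00 qt t00 ltxx.
have tn1 : t < 1.
  by rewrite lt_neqAle t1 andbT; apply: contraTneq q1 => <-; rewrite qt ltxx.
(* [mu] is read off the eigenvector equation at a vertex of outdegree one; the equation at v_g then
   amounts to [qt]. *)
exists t, (alpha + (1 - alpha) / t); split.
- by rewrite tn0.
- suff : 1 - alpha < (1 - alpha) / t by lra.
  by rewrite ltr_pdivlMr// gtr_pMr// subr_gt0.
- by rewrite mulrDl divfK ?gt_eqF.
- apply: (mulIf (lt0r_neq0 tn0)); rewrite mulrDl divfK ?gt_eqF//.
  have tS k : (0 < k)%N -> t ^+ k = t * t ^+ k.-1.
    by move=> k0; rewrite -exprS prednK.
  move: qt; rewrite qE (tS g)// (tS n)//; lra.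
Qed.

(** * Isomorphisms and the distance labelling of C_{n,g} *)

Lemma digraph_iso_sym n (e e' : rel 'I_n) :
  digraph_iso e e' -> digraph_iso e' e.
Proof.
case=> f [h fK hK] fe; exists h; first by exists f.
by move=> x y; rewrite -fe !hK.
Qed.

Lemma digraph_iso_trans n (e e' e'' : rel 'I_n) :
  digraph_iso e e' -> digraph_iso e' e'' -> digraph_iso e e''.
Proof.
case=> f bf fe [h bh he]; exists (h \o f); first exact: bij_comp.
by move=> x y; rewrite /= he fe.
Qed.

(* [Cng n g] with each vertex labelled by its distance to [v_g]. *)
Definition distance_Cng n g : rel 'I_n := fun a b =>
  (a == b.+1 :> nat) || (a == 0 :> nat) && ((b.+1 == g) || (b.+1 == n)).
Arguments distance_Cng : clear implicits.

Lemma Cng_distance_iso n g : (1 < g < n)%N ->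
  digraph_iso (Cng n g) (distance_Cng n g).
Proof.
move=> gn.
(* This is the distance to v_g, which has index [g.-1]: from an index [j >= g] the path runs through
   v_n and v_1. The map reverses both index ranges, so it is its own inverse. *)
have fP (j : 'I_n) : ((if j < g then g.-1 - j else n.-1 + g - j) < n)%N.
  by have := ltn_ord j; case: ifP; lia.
exists (fun j => Ordinal (fP j)).
  exists (fun j => Ordinal (fP j)) => j; apply: val_inj => /=;
  by have jn := ltn_ord j; case: (ltnP j g) => ?; case: ltnP; lia.
move=> x y; rewrite /distance_Cng /Cng /=; have := ltn_ord x; have := ltn_ord y.
by case: (ltnP x g) => ?; case: (ltnP y g); lia.
Qed.

(** * Distances to a vertex and branching on a cycle *)

Lemma exists_distance n (e : rel 'I_n) u : (forall i, connect e i u) ->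
  exists d : 'I_n -> nat, [/\ d u = 0%N, forall i, (d i < n)%N,
    forall i, i != u -> exists2 j, e i j & d i = (d j).+1
    & forall i p, path e i p -> last i p = u -> (d i <= size p)%N].
Proof.
move=> eu.
(* Tuples of fixed length make the existence of a path boolean, as [ex_minn] requires. *)
pose P i k := [exists p : k.-tuple 'I_n, path e i p && (last i p == u)].
have Ppath i p : path e i p -> last i p = u -> P i (size p).
  by move=> ep pu; apply/existsP; exists (in_tuple p); rewrite ep pu eqxx.
have exP i : exists k, P i k.
  have [p [ep pu _]] := connect_path_ltn (eu i).
  by exists (size p); exact: Ppath.
pose d i := ex_minn (exP i).
have d_le i p : path e i p -> last i p = u -> (d i <= size p)%N.
  by move=> ep pu; rewrite /d; case: ex_minnP => m _; apply; exact: Ppath.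
exists d; split=> // [|i|i iu].
- by apply/eqP; rewrite -leqn0 (d_le u [::]).
- have [p [ep pu pn]] := connect_path_ltn (eu i).
  exact: leq_ltn_trans (d_le _ _ ep pu) pn.
- have : P i (d i) by rewrite /d; case: ex_minnP.
  case/existsP => -[[|j p] sp] /=; first by rewrite (negbTE iu).
  case/andP => ep /eqP pu.
  (* The second vertex of a shortest path is exactly one step closer, since a shorter path from [j]
     would shorten the one from [i]. *)
  have /andP[eij ejp] := ep; exists j => //.
  apply/eqP; rewrite eqn_leq -(eqP sp) /= !ltnS (d_le j p)// andbT.
  have : P j (d j) by rewrite /d; case: ex_minnP.
  case/existsP => q /andP[eq /eqP qu].
  rewrite -(size_tuple q) -ltnS -[(size p).+1]/(size (j :: p)) (eqP sp).
  apply: (d_le i (j :: q)) => //=.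
  by rewrite eij.
Qed.

(* A value of [d] at [n - 1] forces all smaller ones, so [d] is onto. *)
Lemma bijective_of_descent n (d : 'I_n -> nat) (dn : forall i, (d i < n)%N) x :
  d x = n.-1 -> (forall i, d i != 0%N -> exists j, d i = (d j).+1) ->
  bijective (fun i => Ordinal (dn i)).
Proof.
move=> dx dS; set f := fun i => _.
have dsub m : exists i, d i = (n.-1 - m)%N.
  elim: m => [|m [i di]]; first by exists x; rewrite subn0.
  (* Subtraction is truncated: once 0 is reached, the same vertex serves for all larger [m]. *)
  have [di0|/dS[j dj]] := eqVneq (d i) 0%N; [exists i|exists j]; lia.
have /boolp.choice[h hP] : forall k : 'I_n, exists i, d i = k.
  move=> k; have [i di] := dsub (n.-1 - k)%N.
  by exists i; have := ltn_ord k; lia.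
have hK : cancel h f by move=> k; apply: val_inj; exact: hP.
have [h' h'K hK'] := injF_bij (can_inj hK).
by exists h => // i; rewrite -(hK' i) hK.
Qed.

(** If every arc leaving [c] followed the cycle, [c] would be closed under arcs and contain all [n]
    vertices. The path [p] is the rest of the cycle, from [x1] back to [u]. *)
Lemma exists_branching n (e : rel 'I_n) c : strongly_connected e ->
  dicycle e c -> (size c < n)%N ->
  exists u x1 x2 p, [/\ e u x1, e u x2, x1 != x2, path e x1 p
    & last x1 p = u /\ (size p).+1 = size c].
Proof.
move=> econ /and3P[c0 ec uc] cn.
have [u [x2 [uc2 eux2 x2n]]] :
    exists u x2, [/\ u \in c, e u x2 & next c u != x2].
  apply: contrapT => H.
  have cl i j : i \in c -> e i j -> j \in c.
    move=> ic eij; have [<-|ne] := eqVneq (next c i) j.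
      by rewrite mem_next.
    by case: H; exists i, j.
  have clp i p : i \in c -> path e i p -> last i p \in c.
    by elim: p i => //= j p IH i ic /andP[/(cl _ _ ic) jc]; exact: IH.
  have [x xc] : exists x, x \in c.
    by case: (c) c0 => // x s _; exists x; rewrite mem_head.
  have : (n <= size c)%N.
    rewrite -(card_uniqP uc) -[leqLHS]card_ord; apply: subset_leq_card.
    apply/fintype.subsetP => z _; have /connectP[p ep ->] := econ x z.
    exact: clp.
  by rewrite leqNgt cn.
exists u, (next c u), x2.
have [k s Es] := rot_to uc2.
have ec' : cycle e (u :: s) by rewrite -Es rot_cycle.
have us' : uniq (u :: s) by rewrite -Es rot_uniq.
have sizes : (size s).+1 = size c.
  by rewrite -[LHS]/(size (u :: s)) -Es size_rot.
have nE : next c u = head u s.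
  rewrite -(next_rot k uc u) Es /=; case: (s) => [|y s'] /=; by rewrite eqxx.
have eun : e u (next c u) by exact: next_cycle ec uc2.
case: s => [|y s] in Es ec' us' sizes nE *.
  exists [::]; split=> //; by rewrite nE.
exists (rcons s u); split=> //.
  by move: ec'; rewrite nE /= => /andP[].
by rewrite last_rcons size_rcons.
Qed.

(** * The lower bound and the equality case *)

Section Extremal.
Variables (R : realType) (alpha t mu : R) (n g : nat).
Hypotheses (alpha01 : 0 <= alpha < 1) (gn : (1 < g < n)%N).
Hypothesis t01 : 0 < t < 1.
Hypothesis mu_t : mu * t = alpha * t + (1 - alpha).
Hypothesis muE : mu = alpha + alpha + (1 - alpha) * (t ^+ g.-1 + t ^+ n.-1).

Let t_gt0 : 0 < t. Proof. by case/andP: t01. Qed.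
Let n_gt0 : (0 < n)%N. Proof. by lia. Qed.

Lemma lambda_alpha_ge (e : rel 'I_n) c : strongly_connected e ->
  dicycle e c -> size c = g ->
  mu <= lambda_alpha alpha e /\
  (lambda_alpha alpha e = mu -> digraph_iso e (distance_Cng n g)).
Proof.
move=> econ ec cg; have /andP[a0 a1] := alpha01; have /andP[g_gt1 _] := gn.
have a1' : 0 < 1 - alpha by rewrite subr_gt0.
have [|u [x1 [x2 [p [eux1 eux2 x12 ep [pu pg]]]]]] := exists_branching econ ec.
  by rewrite cg; case/andP: gn.
rewrite {}cg {c ec} in pg.
have [d [du dn dS dle]] := exists_distance (fun i => econ i u).
have dx1 : (d x1 <= g.-1)%N by rewrite -pg /= dle.
have dx2 : (d x2 <= n.-1)%N by rewrite -ltnS prednK.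
pose y : 'cV[R]_n := \col_i t ^+ d i.
have y0 i : 0 < y i 0 by rewrite mxE exprn_gt0.
(* The contribution of an arc from [i] to [j] to entry [i] of A_alpha y. By [muF], one arc leading a
   step closer to [u] already yields mu y_i. *)
pose F i j := alpha * y i 0 + (1 - alpha) * y j 0.
have F0 i j : 0 < F i j by rewrite ltr_wpDl ?mulr_ge0 ?mulr_gt0 ?(ltW (y0 _)).
have Fs i (P : pred 'I_n) : 0 <= \sum_(j | P j) F i j.
  by apply: sumr_ge0 => j _; exact: ltW.
have muF i j : d i = (d j).+1 -> mu * y i 0 = F i j.
  by move=> dij; rewrite /F !mxE dij exprS mulrA mu_t; ring.
have tle k m : (k <= m)%N -> t ^+ m <= t ^+ k.
  by move=> km; case/andP: t01 => *; rewrite ler_wiXn2l ?ltW.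
have x12F : mu * y u 0 <= F u x1 + F u x2.
  rewrite /F !mxE du expr0 muE.
  have := lerD (tle _ _ dx1) (tle _ _ dx2); rewrite -(ler_pM2l a1'); lra.
have AyE i : (Aalpha alpha e *m y) i 0 = \sum_(j | e i j) F i j.
  exact: Aalpha_mul_col.
have sumu : \sum_(j | e u j) F u j =
    F u x1 + F u x2 + \sum_(j | (e u j && (j != x1)) && (j != x2)) F u j.
  by rewrite (bigD1 x1)//= (bigD1 x2)/= ?addrA// eux2 eq_sym.
have [i|mule mueq] := spectral_radius_ge n_gt0 (e := e) (y := y) (mu := mu)
    (Aalpha_ge0 e alpha01) (Aalpha_gt0 alpha01) econ y0.
  rewrite AyE; have [->|iu] := eqVneq i u.
    by rewrite sumu (le_trans x12F)// lerDl.
  have [j eij dij] := dS _ iu.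
  by rewrite (muF _ _ dij) (bigD1 j)//= lerDl.
(* In the equality case the positive [F] leave no room for further arcs. *)
split=> // /mueq Ay.
have sumE i : \sum_(j | e i j) F i j = mu * y i 0 by rewrite -AyE Ay mxE.
have sum0 i (P : pred 'I_n) : \sum_(j | P j) F i j <= 0 -> forall j, ~~ P j.
  move=> s0 j; apply: contraTN s0 => Pj; rewrite -ltNge (bigD1 j)//=.
  by rewrite ltr_wpDr.
have outE i j : i != u -> e i j -> d i = (d j).+1.
  move=> iu; have [k eik dik] := dS _ iu => eij.
  have := sumE i; rewrite (muF _ _ dik) (bigD1 k)//= => sk.
  have /sum0/(_ j) : \sum_(j | e i j && (j != k)) F i j <= 0 by lra.
  by rewrite eij negbK => /eqP ->.
have outu j : e u j -> (j == x1) || (j == x2).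
  move=> euj; have := sumE u; rewrite sumu => sk.
  have /sum0/(_ j) :
    \sum_(j | e u j && (j != x1) && (j != x2)) F u j <= 0 by lra.
  by rewrite euj /= negb_and !negbK.
have tlt k m : (k < m)%N -> t ^+ m < t ^+ k.
  by move=> km; case/andP: t01 => _ t1; rewrite ltr_iXn2l.
have sumtx : t ^+ d x1 + t ^+ d x2 <= t ^+ g.-1 + t ^+ n.-1.
  have : F u x1 + F u x2 <= mu * y u 0 by rewrite -sumE sumu lerDl.
  rewrite /F !mxE du expr0 muE => Fle; rewrite -(ler_pM2l a1'); lra.
(* Both powers of [t] are at least their bounds, so by [sumtx] neither can be strictly larger. *)
have dx1E : d x1 = g.-1.
  apply/eqP; rewrite eqn_leq dx1 leqNgt; apply/negP => /tlt.
  have := tle _ _ dx2; lra.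
have dx2E : d x2 = n.-1.
  apply/eqP; rewrite eqn_leq dx2 leqNgt; apply/negP => /tlt.
  have := tle _ _ dx1; lra.
have fbij : bijective (fun i => Ordinal (dn i)).
  apply: (bijective_of_descent dn dx2E) => i di.
  have [|j _ ->] := dS i; last by exists j.
  by apply: contraNneq di => ->; rewrite du.
have dinj i j : d i = d j -> i = j.
  by move=> dij; apply: (bij_inj fbij); exact: val_inj.
exists (fun i => Ordinal (dn i)) => // x z; rewrite /distance_Cng /=.
(* Injectivity of [d] identifies out-neighbours by their distances: [g.-1] and [n.-1] at [u], one
   less elsewhere. *)
have [->|xu] := eqVneq x u.
  rewrite du /=.
  have -> : ((d z).+1 == g) = (z == x1).
    rewrite -(ltn_predK g_gt1) -dx1E eqSS.
    by apply/eqP/eqP => [/dinj|->].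
  have -> : ((d z).+1 == n) = (z == x2).
    rewrite -[X in _.+1 == X](prednK n_gt0) -dx2E eqSS.
    by apply/eqP/eqP => [/dinj|->].
  by apply/idP/idP => [/orP[]/eqP ->//|]; exact: outu.
have [j exj dxj] := dS _ xu.
rewrite dxj /= orbF eqSS; apply/eqP/idP => [/dinj <-//|exz].
by have := outE _ _ xu exz; rewrite dxj => -[].
Qed.

Hypothesis mu_gt1 : 1 < mu.

(** [t] to the power of the label is a positive right eigenvector: [muE] is its equation at label 0,
    [mu_t] gives the others. *)
Lemma lambda_alpha_distance (e : rel 'I_n) :
  digraph_iso e (distance_Cng n g) -> lambda_alpha alpha e = mu.
Proof.
case=> f bf fe.
pose y : 'cV[R]_n := \col_i t ^+ (f i).
apply: (spectral_radius_pos_eigenvector n_gt0 (y := y)) => // [i j|i||].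
- exact: Aalpha_ge0.
- by rewrite mxE exprn_gt0.
- exact: le_trans ler01 (ltW mu_gt1).
apply/colP => i; rewrite Aalpha_mul_col !mxE.
pose F (a b : 'I_n) := alpha * t ^+ a + (1 - alpha) * t ^+ b.
transitivity (\sum_(b | distance_Cng n g (f i) b) F (f i) b).
  rewrite [RHS](reindex f) /=; last exact: onW_bij.
  by apply: eq_big => [j|j _]; rewrite ?fe// !mxE.
move: (f i) => a; have an := ltn_ord a; have [a0|a0] := eqVneq (a : nat) 0%N.
  have b1n : (g.-1 < n)%N by lia.
  have b2n : (n.-1 < n)%N by lia.
  (* The two out-neighbours, labelled [g.-1] and [n.-1], are distinct because g < n. *)
  rewrite (bigD1 (Ordinal b1n)) /=; last by rewrite /distance_Cng a0 /=; lia.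
  rewrite (big_pred1 (Ordinal b2n)) => [|b]; last first.
    rewrite /distance_Cng a0 -[b == Ordinal b1n]val_eqE -[RHS]val_eqE /=.
    by have := ltn_ord b; lia.
  by rewrite /F a0 muE /=; ring.
have bn : (a.-1 < n)%N by lia.
rewrite (big_pred1 (Ordinal bn)) => [|b]; last first.
  by rewrite /distance_Cng -[RHS]val_eqE /=; lia.
have ta : t ^+ a = t * t ^+ a.-1 by rewrite -exprS prednK// lt0n.
rewrite /F /= ta [RHS]mulrA mu_t; ring.
Qed.

End Extremal.

Theorem theorem3p1 (R : realType) (alpha : R) (n g : nat) (e : rel 'I_n)
    (halpha : 0 <= alpha < 1) (hg : (2 <= g <= n - 1)%N)
    (hsimple : irreflexive e) (hconn : strongly_connected e)
    (hgirth : has_girth e g) :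
  [/\ lambda_alpha alpha (Cng n g) <= lambda_alpha alpha e,
      1 < lambda_alpha alpha (Cng n g)
    & lambda_alpha alpha e = lambda_alpha alpha (Cng n g)
        <-> digraph_iso e (Cng n g)].
Proof.
have gn : (1 < g < n)%N by lia.
have [||t [mu [t01 mu1 mut muE]]] := @exists_rate _ alpha g n halpha; try lia.
have Cd := Cng_distance_iso gn.
(* This evaluates both C_{n,g} and, for the converse in the equality case, any digraph isomorphic to
   it. *)
have eqmu e' : digraph_iso e' (distance_Cng n g) -> lambda_alpha alpha e' = mu.
  exact: (lambda_alpha_distance halpha gn t01 mut muE mu1).
rewrite (eqmu _ Cd).
have [[c ec cg] _] := hgirth.
have [le_mu eq_mu] := lambda_alpha_ge halpha gn t01 mut muE hconn ec cg.
split=> //; split=> [/eq_mu ed|eC].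
  exact: digraph_iso_trans ed (digraph_iso_sym Cd).
exact/eqmu/(digraph_iso_trans eC).
Qed.
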